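(* For every integer $k \ge 3$, $\mathrm{sdim}(GP(4k+1,2)) \le 5k+5$.
   Context: Let $n,m$ be integers with $n \ge 3$ and $1 \le m < n/2$. The generalized Petersen graph $GP(n,m)$ is the simple undirected graph with vertex set $V = \{u_i, v_i \mid 0 \le i \le n-1\}$ ($2n$ vertices) and edge set $\{\{u_i,u_{i+1}\}, \{u_i,v_i\}, \{v_i,v_{i+m}\} \mid 0 \le i \le n-1\}$, where vertex indices are taken modulo $n$. Let $G$ be a simple connected undirected graph and let $d$ be its shortest-path distance. A vertex $w$ strongly resolves two vertices $u$ and $v$ if $u$ belongs to a shortest $v$–$w$ path or $v$ belongs to a shortest $u$–$w$ path (equivalently, $d(v,w) = d(v,u) + d(u,w)$ or $d(u,w) = d(u,v) + d(v,w)$). A vertex set $S$ of $G$ is a strong resolving set of $G$ if every two distinct vertices of $G$ are strongly resolved by some vertex of $S$. The strong metric dimension $\mathrm{sdim}(G)$ is the minimum cardinality of a strong resolving set of $G$. *)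

(* Defs.v *)
From mathcomp Require Import all_boot.
Set Implicit Arguments.
Unset Strict Implicit.
Unset Printing Implicit Defensive.

(* A simple undirected graph is a symmetric irreflexive relation on a finType. *)
Section Graph.
Variables (T : finType) (e : rel T).

Definition walk_of_length (x y : T) (k : nat) : bool :=
  [exists p : k.-tuple T, path e x p && (last x p == y)].

(* The least length of a walk from x to y: a shortest walk repeats no vertex, so
   lengths below #|T| suffice, and find returns the junk value #|T| when x and y
   lie in different components. *)
Definition dist (x y : T) : nat := find (walk_of_length x y) (iota 0 #|T|).

Definition on_shortest_path (x y z : T) : bool :=
  [exists p : (dist x z).-tuple T,
     [&& path e x p, last x p == z & y \in x :: p]].

Definition strongly_resolves (w u v : T) : bool :=
  on_shortest_path v u w || on_shortest_path u v w.

Definition strong_resolving (S : {set T}) : bool :=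
  [forall u, forall v, (u != v) ==> [exists w in S, strongly_resolves w u v]].

(* In a connected graph [set: T] is strongly resolving, so the minimum is taken
   over a nonempty family; see strong_resolving_setT. *)
Definition sdim : nat :=
  #|[arg min_(S < [set: T] | strong_resolving S) #|S| ]|.

Lemma walk_of_lengthP x y k :
  reflect (exists p, [/\ path e x p, last x p = y & size p = k])
          (walk_of_length x y k).
Proof.
apply: (iffP existsP) => [[p /andP[ep /eqP lp]]|[p [ep lp sp]]].
  by exists p; rewrite size_tuple.
have sp' : size p == k by rewrite sp.
by exists (Tuple sp'); rewrite /= ep lp eqxx.
Qed.

Lemma on_shortest_pathP x y z :
  reflect (exists p, [/\ path e x p, last x p = z, size p = dist x z
                       & y \in x :: p])
          (on_shortest_path x y z).
Proof.
apply: (iffP existsP) => [[p /and3P[ep /eqP lp yp]]|[p [ep lp sp yp]]].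
  by exists p; rewrite size_tuple.
have sp' : size p == dist x z by rewrite sp.
by exists (Tuple sp'); rewrite /= ep lp eqxx.
Qed.

Lemma dist_walk x y : connect e x y -> walk_of_length x y (dist x y).
Proof.
case/connectP=> p0 ep0 ->; case/shortenP: ep0 => p ep up _.
have lt_p : size p < #|T| by move/card_uniqP: up => /= <-; apply: max_card.
have hasw : has (walk_of_length x (last x p)) (iota 0 #|T|).
  apply/hasP; exists (size p); first by rewrite mem_iota.
  by apply/walk_of_lengthP; exists p.
have := nth_find 0 hasw; rewrite nth_iota //.
by move: hasw; rewrite has_find size_iota.
Qed.

Lemma dist_min x p : path e x p -> dist x (last x p) <= size p.
Proof.
move=> ep; rewrite leqNgt; apply/negP => lt_pd.
have lt_pT : size p < #|T|.
  by apply: leq_trans lt_pd _; rewrite -[X in _ <= X](size_iota 0) find_size.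
have := before_find 0 lt_pd; rewrite nth_iota // add0n => /walk_of_lengthP[].
by exists p.
Qed.

Hypothesis e_conn : forall x y, connect e x y.

Lemma on_shortest_pathE x y z :
  on_shortest_path x y z = (dist x z == dist x y + dist y z).
Proof.
have tri a b c : dist a c <= dist a b + dist b c.
  have /walk_of_lengthP[p [ep lp <-]] := dist_walk (e_conn a b).
  have /walk_of_lengthP[q [eq lq <-]] := dist_walk (e_conn b c).
  have epq : path e a (p ++ q) by rewrite cat_path ep lp.
  by have := dist_min epq; rewrite last_cat lp lq size_cat.
apply/on_shortest_pathP/eqP => [[p [ep lp sp]]|dE].
  move=> yp; apply/eqP; rewrite eqn_leq tri -sp /=.
  case/splitPl: yp ep lp {sp} => p1 p2 lp1.
  rewrite cat_path last_cat lp1 size_cat => /andP[ep1 ep2] lp2.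
  by rewrite leq_add // -?lp1 -?lp2 ?dist_min //  lp1 dist_min.
have /walk_of_lengthP[p [ep lp sp]] := dist_walk (e_conn x y).
have /walk_of_lengthP[q [eq lq sq]] := dist_walk (e_conn y z).
exists (p ++ q); rewrite cat_path ep lp last_cat lp size_cat sp sq -cat_cons.
by split=> //; rewrite ?eq // mem_cat -[in y \in _]lp mem_last.
Qed.

Lemma strong_resolving_setT : strong_resolving [set: T].
Proof.
apply/'forall_forallP => u v; apply/implyP => _; apply/existsP; exists u.
have dd : dist u u = 0 by apply/eqP; rewrite -leqn0 (@dist_min u [::]).
by rewrite inE /strongly_resolves on_shortest_pathE dd addn0 eqxx.
Qed.

Lemma sdimP : exists2 S, strong_resolving S & #|S| = sdim.
Proof.
rewrite /sdim; case: arg_minnP => [|S]; first exact: strong_resolving_setT.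
by exists S.
Qed.

Lemma sdim_min S : strong_resolving S -> sdim <= #|S|.
Proof.
rewrite /sdim; case: arg_minnP => [|S0 _]; first exact: strong_resolving_setT.
exact.
Qed.

End Graph.

(* The vertex u_i is inl i and v_i is inr i. *)
Definition gp_vertex (n : nat) : finType := ('I_n + 'I_n)%type.

Definition gp_arc (n m : nat) : rel (gp_vertex n) := fun x y =>
  match x, y with
  | inl i, inl j => j == (i + 1) %% n :> nat
  | inl i, inr j => i == j
  | inr i, inr j => j == (i + m) %% n :> nat
  | inr _, inl _ => false
  end.

Definition GP (n m : nat) : rel (gp_vertex n) :=
  fun x y => gp_arc m x y || gp_arc m y x.

Lemma GP_sym n m : symmetric (@GP n m).
Proof. by move=> x y; rewrite /GP orbC. Qed.

Lemma GP_irrefl n m : 0 < m -> m.*2 < n -> irreflexive (@GP n m).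
Proof.
move=> m0 mn; have key d (i : 'I_n) : 0 < d -> d < n -> i == (i + d) %% n :> nat = false.
  move=> d0 dn; apply/negP => /eqP ei.
  have /eqP : i + 0 = i + d %[mod n] by rewrite addn0 -ei modn_small.
  by rewrite eqn_modDl mod0n modn_small // eq_sym eqn0Ngt d0.
have m_n : m < n by apply: leq_ltn_trans mn; rewrite -addnn leq_addr.
by case=> i; rewrite /GP /= orbb key // (leq_ltn_trans m0).
Qed.

Lemma GP_connected n m x y : connect (@GP n m) x y.
Proof.
have cs : connect_sym (@GP n m) by apply/sym_connect_sym/GP_sym.
have u0 (i j : 'I_n) : val j = 0 -> connect (@GP n m) (inl j) (inl i).
  move=> j0; case: i => i; elim: i => [|i IH] lt_in.
    by rewrite (_ : j = Ordinal lt_in) //; apply/val_inj.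
  apply: connect_trans (IH (ltnW lt_in)) _; apply: connect1.
  by rewrite /GP /= addn1 modn_small // eqxx.
have uu (i j : 'I_n) : connect (@GP n m) (inl i) (inl j).
  have n0 : 0 < n by apply: leq_ltn_trans (ltn_ord i).
  by apply: (@connect_trans _ _ (inl (Ordinal n0))); [rewrite cs|]; apply: u0.
have uv (i : 'I_n) : connect (@GP n m) (inl i) (inr i).
  by apply: connect1; rewrite /GP /= eqxx.
case: x y => i [] j //.
- exact: connect_trans (uu i j) (uv j).
- by rewrite cs; apply: connect_trans (uu j i) (uv i).
- apply: (@connect_trans _ _ (inl i)); first by rewrite cs.
  exact: connect_trans (uu i j) (uv j).
Qed.

(* Main.v *)
Require Import Defs.
From mathcomp Require Import all_boot.
From mathcomp Require Import zify.

(** Write u_i, v_i for the outer and inner vertices, n = 4k+1, and call g(i,j)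
    the distance from i to j around the n-cycle. The idea is to keep as few
    vertices as possible out of a resolving set: it suffices that every pair of
    omitted vertices lies on a geodesic that continues, past one of the two, to
    a vertex that is not omitted. Pairs of vertices for which no geodesic can be
    prolonged at either end are rare: they are u_i, u_j with g(i,j) odd and at
    least 5 or g(i,j) = 2k, and v_i, v_j with g(i,j) equal to 2k-3 or 2k-1. The
    omitted vertices are therefore chosen as

      u_2, u_4, ..., u_2k   (all gaps even and at most 2k-2), and
      v_2, v_3, ..., v_(2k-2)   (all gaps at most 2k-4).

    These are k + (2k-3) = 3k-3 of the 2n = 8k+2 vertices, so 5k+5 remain. The
    window starts at index 2 in order that all the geodesics below stay among
    the indices 0, ..., 2k+1 and never cross the index n-1:

    - a geodesic from u_i to u_j, i < j, continues to u_(j+1);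
    - a geodesic ending in v_j continues in steps of two away from its origin
      until it passes all omitted v_i, at index 2k-1 or 2k when it travels
      upwards and at 0 or 1 when it travels downwards.

    That these walks are geodesics needs upper bounds on the two pieces, given
    by exhibiting walks, and a lower bound on the whole. The lower bound comes
    from a potential: a function that changes by at most 1 along each edge
    cannot grow faster than the distance (potential_le_dist). The potentials
    are the closed formulas for the distance from u_i and from v_i. *)

(** * Distances in a connected graph *)

Section Distance.
Variables (T : finType) (e : rel T).
Hypothesis e_conn : forall x y, connect e x y.

Lemma dist_triangle x y z : dist e x z <= dist e x y + dist e y z.
Proof.
have /walk_of_lengthP[p [ep lp <-]] := dist_walk (e_conn x y).
have /walk_of_lengthP[q [eq lq <-]] := dist_walk (e_conn y z).
have epq : path e x (p ++ q) by rewrite cat_path ep lp.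
by have := dist_min epq; rewrite last_cat lp lq size_cat.
Qed.

Lemma dist_refl x : dist e x x = 0.
Proof. by apply/eqP; rewrite -leqn0 (@dist_min _ e x [::]). Qed.

Lemma dist_edge x y : e x y -> dist e x y <= 1.
Proof. by move=> exy; apply: (@dist_min _ e x [:: y]); rewrite /= exy. Qed.

Lemma dist_sym x y : symmetric e -> dist e x y = dist e y x.
Proof.
move=> e_sym.
suff le a b : dist e a b <= dist e b a by apply/eqP; rewrite eqn_leq !le.
have /walk_of_lengthP[p [ep lp <-]] := dist_walk (e_conn b a).
have : path e (last b p) (rev (belast b p)).
  by rewrite rev_path (eq_path (e' := e)) // => x' y'; rewrite e_sym.
move/dist_min; rewrite size_rev size_belast lp.
by case: p {ep} lp => [|c p] /= lp; rewrite ?lp // rev_cons last_rcons.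
Qed.

(** Turns lower bounds on distances into a check on single edges. *)
Lemma potential_le_dist (phi : T -> nat) x y :
    (forall a b, e a b -> phi b <= phi a + 1) ->
  phi y <= phi x + dist e x y.
Proof.
move=> phi_lip.
have /walk_of_lengthP[p [ep lp <-]] := dist_walk (e_conn x y).
elim: p x ep lp => [|a p IHp] x /= => [_ ->|/andP[/phi_lip exa ep] lp].
  by rewrite addn0.
by have := IHp a ep lp; lia.
Qed.

(** The form in which geodesics are certified: explicit walks bound the two
    pieces from above, the potential bounds the whole from below, and the
    triangle inequality leaves no room in between. *)
Lemma potential_shortest (phi : T -> nat) x y z s t :
    (forall a b, e a b -> phi b <= phi a + 1) ->
    dist e x y <= s -> dist e y z <= t -> phi x + s + t <= phi z ->
  on_shortest_path e x y z.
Proof.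
move=> /(@potential_le_dist phi x z) lo hs ht hz.
by rewrite on_shortest_pathE //; have := dist_triangle x y z; lia.
Qed.

End Distance.

(** * Walks in GP(n,2) *)

Section Petersen.
Variable n : nat.

Local Notation e := (@GP n 2).
Local Notation d := (dist e).
Local Notation u i := (inl i : gp_vertex n).
Local Notation v i := (inr i : gp_vertex n).

Let conn : forall x y, connect e x y := @GP_connected n 2.

Let dC x y : d x y = d y x.
Proof. by apply: dist_sym => //; apply: GP_sym. Qed.

Let tri x y z : d x z <= d x y + d y z.
Proof. exact: dist_triangle. Qed.

Lemma dist_spoke (i j : 'I_n) : i = j :> nat -> d (u i) (v j) <= 1.
Proof. by move=> /val_inj->; apply: dist_edge => //; rewrite /GP /= eqxx. Qed.

Lemma dist_outer_step (i j : 'I_n) : j = i + 1 :> nat -> d (u i) (u j) <= 1.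
Proof.
move=> ij; apply: dist_edge => //.
by rewrite /GP /= -ij modn_small ?eqxx.
Qed.

Lemma dist_inner_step (i j : 'I_n) : j = i + 2 :> nat -> d (v i) (v j) <= 1.
Proof.
move=> ij; apply: dist_edge => //.
by rewrite /GP /= -ij modn_small ?eqxx.
Qed.

Lemma dist_outer_arc g (i j : 'I_n) : j = i + g :> nat -> d (u i) (u j) <= g.
Proof.
elim: g j => [|g IHg] j gE.
  by rewrite (_ : j = i) ?dist_refl //; apply: ord_inj; rewrite gE addn0.
have lt_jn : i + g < n by have := ltn_ord j; lia.
have := IHg (Ordinal lt_jn) erefl.
have := tri (u i) (u (Ordinal lt_jn)) (u j).
by have := @dist_outer_step (Ordinal lt_jn) j; rewrite /=; lia.
Qed.

Lemma dist_inner_even g (i j : 'I_n) : j = i + g.*2 :> nat -> d (v i) (v j) <= g.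
Proof.
elim: g j => [|g IHg] j gE.
  by rewrite (_ : j = i) ?dist_refl //; apply: ord_inj; rewrite gE addn0.
have lt_jn : i + g.*2 < n by have := ltn_ord j; lia.
have := IHg (Ordinal lt_jn) erefl.
have := tri (v i) (v (Ordinal lt_jn)) (v j).
by have := @dist_inner_step (Ordinal lt_jn) j; rewrite /=; lia.
Qed.

(** Inner edges cover two indices at once, so a walk descends to the inner
    vertices as soon as possible; an odd difference costs one outer edge. *)
Lemma dist_outer_inner (i j : 'I_n) : i <= j ->
  d (u i) (v j) <= 1 + uphalf (j - i).
Proof.
move=> le_ij; case: (boolP (odd (j - i))) => [odd_g|even_g].
  have lt_in : i + 1 < n by have := ltn_ord j; lia.
  have := tri (u i) (u (Ordinal lt_in)) (v j).
  have := @dist_outer_step i (Ordinal lt_in) erefl.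
  have := tri (u (Ordinal lt_in)) (v (Ordinal lt_in)) (v j).
  have := @dist_spoke (Ordinal lt_in) _ erefl.
  by have := @dist_inner_even (j - i)./2 (Ordinal lt_in) j; rewrite /=; lia.
have := tri (u i) (v i) (v j); have := @dist_spoke i i erefl.
by have := @dist_inner_even (j - i)./2 i j; lia.
Qed.

(** The mirror image of the previous walk: here an odd difference is repaired at
    the end, which keeps all indices between i and j. *)
Lemma dist_inner_outer (i j : 'I_n) : i <= j ->
  d (v i) (u j) <= 1 + uphalf (j - i).
Proof.
move=> le_ij; case: (boolP (odd (j - i))) => [odd_g|even_g].
  have lt_jn : j.-1 < n by have := ltn_ord j; lia.
  have := tri (v i) (u (Ordinal lt_jn)) (u j).
  have := @dist_outer_step (Ordinal lt_jn) j.
  have := tri (v i) (v (Ordinal lt_jn)) (u (Ordinal lt_jn)).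
  have := @dist_spoke (Ordinal lt_jn) _ erefl; rewrite dC.
  by have := @dist_inner_even (j - i)./2 i (Ordinal lt_jn); rewrite /=; lia.
have := tri (v i) (v j) (u j); have := @dist_spoke j j erefl; rewrite dC.
by have := @dist_inner_even (j - i)./2 i j; lia.
Qed.

Lemma dist_outer (i j : 'I_n) : i <= j ->
  d (u i) (u j) <= minn (j - i) (2 + uphalf (j - i)).
Proof.
move=> le_ij; have := @dist_outer_arc (j - i) i j.
have := dist_inner_outer _ _ le_ij.
have := tri (u i) (v i) (u j); have := @dist_spoke i i erefl.
by lia.
Qed.

(** The cost of going from v_i to v_(i+g) without turning back: an odd g forces
    one outer edge, hence a detour along two spokes. *)
Definition inner_dist g := uphalf g + (odd g).*2.

Lemma dist_inner (i j : 'I_n) : i <= j -> d (v i) (v j) <= inner_dist (j - i).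
Proof.
move=> le_ij; rewrite /inner_dist; case: (boolP (odd (j - i))) => odd_g.
  have := dist_outer_inner _ _ le_ij.
  have := tri (v i) (u i) (v j); have := @dist_spoke i i erefl; rewrite dC.
  by lia.
by apply: dist_inner_even; lia.
Qed.

(** * Potentials *)

Definition gap i j := (i - j) + (j - i).
Definition cyclic_gap i j := minn (gap i j) (n - gap i j).

(** The distance from u_i: between outer vertices one either stays outside or
    pays two spokes in order to move by two. *)
Definition outer_potential i (x : gp_vertex n) :=
  match x with
  | inl j => minn (cyclic_gap i j) (2 + uphalf (cyclic_gap i j))
  | inr j => 1 + uphalf (cyclic_gap i j)
  end.

(** The distance from v_i. Between inner vertices the direction matters and not
    only the smaller gap: when n is odd, one of the two directions has an even
    gap, and it can be the better one although it is longer. *)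
Definition inner_potential i (x : gp_vertex n) :=
  match x with
  | inl j => 1 + uphalf (cyclic_gap i j)
  | inr j => minn (inner_dist (gap i j)) (inner_dist (n - gap i j))
  end.

Lemma step_mod j s : j < n -> s < n ->
  (j + s) %% n = if j + s < n then j + s else j + s - n.
Proof.
move=> lt_jn lt_sn; case: ifPn => [/modn_small//|]; rewrite -leqNgt => le_n.
by rewrite -{1}(subnK le_n) modnDr modn_small //; lia.
Qed.

Lemma cyclic_gap_step i j s : i < n -> j < n -> s < n ->
  cyclic_gap i ((j + s) %% n) <= cyclic_gap i j + s
  /\ cyclic_gap i j <= cyclic_gap i ((j + s) %% n) + s.
Proof.
move=> lt_in lt_jn lt_sn; rewrite /cyclic_gap /gap step_mod //.
by case: ifP; lia.
Qed.

Lemma inner_distD g t : inner_dist (g + t.*2) = inner_dist g + t.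
Proof. by rewrite /inner_dist oddD odd_double addbF; lia. Qed.

(** Going the other way round can at best save the detour along the spokes,
    which is worth a gap of 5. *)
Lemma inner_dist_short g : g.*2 + 5 <= n -> inner_dist g <= inner_dist (n - g).
Proof. by rewrite /inner_dist; lia. Qed.

(** A step of two changes one of the two gaps around the cycle by +2 and the
    other by -2, possibly exchanging their names; when it jumps over i, the
    pair of gaps is unchanged. *)
Lemma inner_gap_step i j : 2 < n -> i < n -> j < n ->
  let dist_from k := minn (inner_dist (gap i k)) (inner_dist (n - gap i k)) in
  dist_from ((j + 2) %% n) <= dist_from j + 1
  /\ dist_from j <= dist_from ((j + 2) %% n) + 1.
Proof.
move=> n_gt2 lt_in lt_jn /=; rewrite step_mod //.
set j' := if _ then _ else _; set g := gap i j; set g' := gap i j'.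
have : [\/ g' = g + 2 /\ n - g = n - g' + 2, g = g' + 2 /\ n - g' = n - g + 2,
        g' = g | n - g = g' + 2 /\ n - g' = g + 2 \/ n - g = g' /\ n - g' = g].
  rewrite {}/g {}/g' {}/j' /gap; case: ltnP => wrap.
    have [le_ij|lt_ji] := leqP i j; first by apply: Or41; lia.
    have [eq_i|neq_i] := eqVneq i (j + 1); first by apply: Or43; lia.
    by apply: Or42; lia.
  apply: Or44; have [le_ij|lt_ji] := leqP i j; last by right; lia.
  by have [le_ji|lt_ij] := leqP (j + 2 - n) i; [left|right]; lia.
by case=> [[-> ->]|[-> ->]|->|[[-> ->]|[-> ->]]]; rewrite ?(inner_distD _ 1); lia.
Qed.

Lemma GP_potential_lip (phi : gp_vertex n -> nat) :
    (forall i j : 'I_n, j = (i + 1) %% n :> nat ->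
       phi (u j) <= phi (u i) + 1 /\ phi (u i) <= phi (u j) + 1) ->
    (forall i : 'I_n, phi (u i) <= phi (v i) + 1 /\ phi (v i) <= phi (u i) + 1) ->
    (forall i j : 'I_n, j = (i + 2) %% n :> nat ->
       phi (v j) <= phi (v i) + 1 /\ phi (v i) <= phi (v j) + 1) ->
  forall x y, e x y -> phi y <= phi x + 1.
Proof.
move=> outer spoke inner [] i [] j; rewrite /GP /= ?orbF.
- by case/orP=> /eqP/outer[].
- by move/eqP->; case: (spoke j).
- by move/eqP->; case: (spoke i).
- by case/orP=> /eqP/inner[].
Qed.

Lemma outer_potential_lip i x y :
  2 < n -> i < n -> e x y -> outer_potential i y <= outer_potential i x + 1.
Proof.
move=> n_gt2 lt_in; apply: GP_potential_lip => {x y} [j k /= ->|j|j k /= ->] /=.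
- by have := @cyclic_gap_step i j 1 lt_in (ltn_ord j); lia.
- by lia.
- by have := @cyclic_gap_step i j 2 lt_in (ltn_ord j); lia.
Qed.

Lemma inner_potential_lip i x y :
    2 < n -> i < n -> e x y ->
  inner_potential i y <= inner_potential i x + 1.
Proof.
move=> n_gt2 lt_in.
apply: GP_potential_lip => {x y} [j k /= ->|j|j k /= ->] /=.
- by have := @cyclic_gap_step i j 1 lt_in (ltn_ord j); lia.
- have := ltn_ord j; rewrite /inner_dist /cyclic_gap /gap => lt_jn.
  by lia.
- exact: inner_gap_step n_gt2 lt_in (ltn_ord j).
Qed.

(** * Geodesics that can be prolonged *)

(** Rounding up makes this work: from an even to the next odd difference both
    g and 2 + ceil(g/2) increase by one. *)
Lemma outer_outer_shortest (i j k : 'I_n) : 2 < n -> i < j -> ~~ odd (j - i) ->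
  k = j + 1 :> nat -> (k - i).*2 <= n ->
  on_shortest_path e (u i) (u j) (u k).
Proof.
move=> n_gt2 lt_ij even_ij kE short.
apply: (potential_shortest _ _ conn (outer_potential i)) => [x y|||].
- exact: outer_potential_lip.
- exact: (dist_outer _ _ (ltnW lt_ij)).
- exact: dist_outer_step.
- by rewrite /= /cyclic_gap /gap; lia.
Qed.

(** The walk from i to j may use outer edges; prolonging it by pairs of indices
    costs one inner edge each, as long as the way round is not shorter. *)
Lemma inner_inner_shortest (i j k : 'I_n) : 2 < n ->
    i <= j -> j <= k -> ~~ odd (k - j) -> (k - i).*2 + 5 <= n ->
  on_shortest_path e (v i) (v j) (v k).
Proof.
move=> n_gt2 le_ij le_jk even_jk short.
apply: (potential_shortest _ _ conn (inner_potential i)) => [x y|||].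
- exact: inner_potential_lip.
- exact: dist_inner.
- by apply: (@dist_inner_even (k - j)./2); lia.
- have -> : k - j = (k - j)./2.*2 by lia.
  rewrite doubleK /= /gap !subnn addn0 {1}/inner_dist min0n.
  have -> : i - k + (k - i) = j - i + (k - j)./2.*2 by lia.
  by rewrite -inner_distD leq_min leqnn /=; apply: inner_dist_short; lia.
Qed.

(** Prolonging on the inner side preserves the parity of the difference, so that
    rounding up gains nothing along the way. *)
Lemma outer_inner_shortest (i j k : 'I_n) : 2 < n ->
    (i <= j <= k) || (k <= j <= i) -> ~~ odd (gap j k) ->
    (gap i k).*2 <= n ->
  on_shortest_path e (u i) (v j) (v k).
Proof.
move=> n_gt2 order even_jk short.
apply: (potential_shortest _ _ conn (outer_potential i) _ _ _
          (1 + uphalf (gap i j)) (gap j k)./2) => [x y|||].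
- exact: outer_potential_lip.
- rewrite /gap; case: (leqP i j) => [le_ij|/ltnW le_ji].
    by have := dist_outer_inner _ _ le_ij; lia.
  by rewrite dC; have := dist_inner_outer _ _ le_ji; lia.
- move: even_jk; rewrite /gap => even_jk.
  by case: (leqP j k) => le_jk; last rewrite dC; apply: dist_inner_even; lia.
- by move: even_jk short; rewrite /= /cyclic_gap /gap; lia.
Qed.

End Petersen.

(** * The resolving set *)

(** The vertices left out of the resolving set. Outer ones are spaced by two
    because odd gaps from 5 on cannot be prolonged; the inner interval is as long
    as it can be without containing a gap of 2k-3. *)
Definition spared {k} (x : gp_vertex (4 * k + 1)) : bool :=
  match x with
  | inl i => [&& ~~ odd i, 2 <= i & i <= 2 * k]
  | inr i => 2 <= i <= 2 * k - 2
  end.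

Definition resolver k : {set gp_vertex (4 * k + 1)} := [set x | ~~ spared x].

Lemma card_spared k : 3 <= k -> 3 * k - 3 <= #|[set x | @spared k x]|.
Proof.
move=> k_ge3.
have lt_outer (a : 'I_k) : 2 * a + 2 < 4 * k + 1 by have := ltn_ord a; lia.
have lt_inner (a : 'I_(2 * k - 3)) : a + 2 < 4 * k + 1.
  by have := ltn_ord a; lia.
pose f (a : 'I_k + 'I_(2 * k - 3)) : gp_vertex (4 * k + 1) :=
  match a with
  | inl a => inl (Ordinal (lt_outer a))
  | inr a => inr (Ordinal (lt_inner a))
  end.
have f_inj : injective f.
  move=> [a|a] [b|b] //= [] eq_ab; congr (_ _); apply: ord_inj; lia.
have <- : #|f @: setT| = 3 * k - 3.
  by rewrite card_imset // cardsT card_sum !card_ord; lia.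
apply: subset_leq_card; apply/subsetP => x /imsetP[[a|a] _ ->];
  by rewrite inE /=; have := ltn_ord a; lia.
Qed.

Lemma resolver_strong k : 3 <= k ->
  strong_resolving (@GP (4 * k + 1) 2) (resolver k).
Proof.
move=> k_ge3; pose e := @GP (4 * k + 1) 2.
pose resolved x y := [exists w in resolver k, strongly_resolves e w x y].
have sym x y : resolved x y -> resolved y x.
  case/exists_inP=> w Sw xyw; apply/exists_inP; exists w => //.
  by rewrite /strongly_resolves orbC.
have by_path x y w : ~~ spared w -> on_shortest_path e x y w -> resolved x y.
  move=> Sw xyw; apply/exists_inP; exists w; first by rewrite inE.
  by rewrite /strongly_resolves xyw orbT.
have n_gt2 : 2 < 4 * k + 1 by lia.
have outer_outer (i j : 'I_(4 * k + 1)) :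
    spared (inl i) -> spared (inl j) -> i < j -> resolved (inl i) (inl j).
  move=> /= si sj lt_ij.
  have lt_wn : j + 1 < 4 * k + 1 by lia.
  apply: (by_path _ _ (inl (Ordinal lt_wn))); first by rewrite /=; lia.
  by apply: outer_outer_shortest => //=; lia.
have inner_inner (i j : 'I_(4 * k + 1)) :
    spared (inr i) -> spared (inr j) -> i < j -> resolved (inr i) (inr j).
  move=> /= si sj lt_ij.
  (* the number with the parity of j among 2k-1 and 2k, just above the
     omitted inner indices *)
  have lt_wn : 2 * k - odd j < 4 * k + 1 by lia.
  apply: (by_path _ _ (inr (Ordinal lt_wn))); first by rewrite /=; lia.
  by apply: inner_inner_shortest => //=; lia.
have outer_inner (i j : 'I_(4 * k + 1)) : spared (inl i) -> spared (inr j) ->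
    resolved (inl i) (inr j).
  move=> /= si sj; case: (leqP i j) => order.
    have lt_wn : 2 * k - odd j < 4 * k + 1 by lia.
    apply: (by_path _ _ (inr (Ordinal lt_wn))); first by rewrite /=; lia.
    by apply: outer_inner_shortest => //=; rewrite /gap /=; lia.
  (* likewise among 0 and 1, just below them *)
  have lt_wn : odd j < 4 * k + 1 by lia.
  apply: (by_path _ _ (inr (Ordinal lt_wn))); first by rewrite /=; lia.
  by apply: outer_inner_shortest => //=; rewrite /gap /=; lia.
apply/'forall_forallP => x y; apply/implyP => neq_xy.
rewrite -/(resolved x y).
have end_path z t : on_shortest_path e z t t.
  by rewrite on_shortest_pathE ?dist_refl ?addn0 //; apply: GP_connected.
have [sy|/by_path sy] := boolP (spared y); last exact/sy/end_path.
have [sx|/by_path sx] := boolP (spared x); last exact/sym/sx/end_path.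
case: x y neq_xy sx sy => i [] j neq_ij si sj.
- have [lt_ij|lt_ji|eq_ij] := ltngtP i j.
  + exact: outer_outer.
  + exact/sym/outer_outer.
  + by rewrite (ord_inj eq_ij) eqxx in neq_ij.
- exact: outer_inner.
- exact/sym/outer_inner.
- have [lt_ij|lt_ji|eq_ij] := ltngtP i j.
  + exact: inner_inner.
  + exact/sym/inner_inner.
  + by rewrite (ord_inj eq_ij) eqxx in neq_ij.
Qed.

Theorem corollary1 (k : nat) (hk : 3 <= k) :
  sdim (@GP (4 * k + 1) 2) <= 5 * k + 5.
Proof.
apply: leq_trans (sdim_min (@GP_connected _ _) (resolver_strong _ hk)) _.
have -> : resolver k = ~: [set x | spared x] by apply/setP => x; rewrite !inE.
have := cardsC [set x | @spared k x].
by rewrite card_sum !card_ord; have := card_spared _ hk; lia.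
Qed.
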